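(* Let $1<p<\infty$, let $q$ be the conjugate exponent of $p$, and suppose that $$C_o:=\sup_{n\ge 0}\sum_{k=0}^{n}\left(\frac{\delta_n\beta(n)}{\delta_k\delta_{n-k}\beta(k)\beta(n-k)}\right)^{q}<\infty .$$ Then for every $f\in\ell^p(\beta)$ the operator $M_{\diamond,f}$ maps $\ell^p(\beta)$ into itself and satisfies $\|M_{\diamond,f}\|\le C_o^{1/q}\|f\|_\beta$, and $(\ell^p(\beta),\diamond)$ is a unital commutative Banach algebra whose unit is the constant series $1$.
   Context: Let $\{\beta(n)\}_{n\ge 0}$ and $\{\delta_n\}_{n\ge 0}$ be sequences of positive numbers with $\beta(0)=1$ and $\delta_0=1$. For $1\le p<\infty$, $\ell^p(\beta)$ is the Banach space of complex sequences $f=\{\hat f(n)\}_{n\ge 0}$, written as formal power series $f(z)=\sum_{n\ge 0}\hat f(n)z^n$ (no convergence required), with $\|f\|_\beta^p=\sum_{n\ge 0}|\hat f(n)|^p\beta(n)^p<\infty$. The weighted Cauchy product is $f\diamond g=\sum_{n\ge 0}\sum_{m\ge 0}\frac{\delta_{n+m}}{\delta_n\delta_m}\hat f(n)\hat g(m)z^{n+m}$, i.e. $\widehat{(f\diamond g)}(n)=\sum_{k=0}^n\frac{\delta_n}{\delta_k\delta_{n-k}}\hat f(k)\hat g(n-k)$. For $f\in\ell^p(\beta)$, $M_{\diamond,f}(g)=f\diamond g$ is a linear map from $\ell^p(\beta)$ to the space of all formal power series. ''Banach algebra'' is used in the sense that the space is complete and closed under the associative bilinear product, and $\|f\diamond g\|_\beta\le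 K\|f\|_\beta\|g\|_\beta$ for some finite constant $K$ (not necessarily $K=1$). *)

(* Defs.v *)
From HB Require Import structures.
From mathcomp Require Import all_boot all_order all_algebra.
From mathcomp Require Import complex.
From mathcomp Require Import all_classical all_reals all_analysis.
Set Implicit Arguments.
Unset Strict Implicit.
Unset Printing Implicit Defensive.
Import Order.TTheory GRing.Theory Num.Theory.
Import numFieldNormedType.Exports.
Local Open Scope classical_set_scope.
Local Open Scope ring_scope.
Local Open Scope complex_scope.

(** Normed spaces are given as a linear subspace [E] of an ambient complex
    vector space [V], with a real-valued function [N] that is only meaningful
    on [E]. *)

Record is_banach_space (R : realType) (V : lmodType R[i])
    (E : set V) (N : V -> R) : Prop := IsBanachSpace {
  banach_zero : E 0 ;
  banach_add : forall f g, E f -> E g -> E (f + g) ;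
  banach_scale : forall (a : R[i]) f, E f -> E (a *: f) ;
  banach_norm_eq0 : forall f, E f -> N f = 0 -> f = 0 ;
  banach_norm_scale : forall (a : R[i]) f, E f -> N (a *: f) = Normc.normc a * N f ;
  banach_norm_triangle : forall f g, E f -> E g -> N (f + g) <= N f + N g ;
  banach_complete : forall F : nat -> V,
    (forall n, E (F n)) ->
    (forall e : R, 0 < e -> exists n0 : nat, forall m n : nat,
       (n0 <= m)%N -> (n0 <= n)%N -> N (F m - F n) < e) ->
    exists2 f, E f & (fun n => N (F n - f)) @ \oo --> (0 : R)
}.

(** The norm is submultiplicative only up to a constant. *)
Record is_banach_algebra (R : realType) (V : lmodType R[i])
    (E : set V) (N : V -> R) (mul : V -> V -> V) : Prop := IsBanachAlgebra {
  algebra_banach : is_banach_space E N ;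
  algebra_mul : forall f g, E f -> E g -> E (mul f g) ;
  algebra_mulA : forall f g h, E f -> E g -> E h ->
    mul f (mul g h) = mul (mul f g) h ;
  algebra_linearl : forall (a : R[i]) f g h, E f -> E g -> E h ->
    mul (a *: f + g) h = a *: mul f h + mul g h ;
  algebra_linearr : forall (a : R[i]) f g h, E f -> E g -> E h ->
    mul f (a *: g + h) = a *: mul f g + mul f h ;
  algebra_norm_mul : exists K : R, forall f g, E f -> E g ->
    N (mul f g) <= K * (N f * N g)
}.

Record is_unital_commutative_banach_algebra (R : realType) (V : lmodType R[i])
    (E : set V) (N : V -> R) (mul : V -> V -> V) (e : V) : Prop :=
  IsUnitalCommutativeBanachAlgebra {
  unital_algebra : is_banach_algebra E N mul ;
  unital_mulC : forall f g, E f -> E g -> mul f g = mul g f ;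
  unital_one : E e ;
  unital_mul1 : forall f, E f -> mul e f = f
}.

(** Meaningful for [T] mapping [E] into itself. *)
Definition operator_norm (R : realType) (V : lmodType R[i])
    (E : set V) (N : V -> R) (T : V -> V) : \bar R :=
  ereal_sup [set (N (T g))%:E | g in [set g | E g /\ N g <= 1]].

(** A formal power series is identified with its coefficient sequence.  Only
    the pointwise linear structure of this function type is used, never its
    pointwise product. *)
Definition fps (R : realType) := nat -> R[i].

HB.instance Definition _ (R : realType) :=
  GRing.Lmodule.copy (fps R) (nat -> R[i]^o).

Definition lpbeta_powsum (R : realType) (p : R) (beta : nat -> R)
    (f : fps R) : \bar R :=
  (\sum_(0 <= n <oo) (Normc.normc (f n) `^ p * beta n `^ p)%:E)%E.

Definition lpbeta (R : realType) (p : R) (beta : nat -> R) : set (fps R) :=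
  [set f | (lpbeta_powsum p beta f < +oo)%E].

Definition lpbeta_norm (R : realType) (p : R) (beta : nat -> R)
    (f : fps R) : R :=
  fine (lpbeta_powsum p beta f) `^ p^-1.

Definition fps_one (R : realType) : fps R := fun n => (n == 0%N)%:R.

(** The weighted Cauchy product; [diamond delta f] is the multiplication
    operator by [f]. *)
Definition diamond (R : realType) (delta : nat -> R) (f g : fps R) : fps R :=
  fun n => \sum_(k < n.+1)
    (delta n / (delta k * delta (n - k)%N))%:C * f k * g (n - k)%N.

Definition diamond_const (R : realType) (q : R) (beta delta : nat -> R)
    : \bar R :=
  ereal_sup (range (fun n : nat =>
    (\sum_(k < n.+1)
       (delta n * beta n /
        (delta k * delta (n - k)%N * beta k * beta (n - k)%N)) `^ q)%:E)).

(* Main.v *)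
Require Import Defs.
From HB Require Import structures.
From mathcomp Require Import all_boot all_order all_algebra.
From mathcomp Require Import complex.
From mathcomp Require Import all_classical all_reals all_analysis.
From mathcomp Require Import ring.
Import Order.TTheory GRing.Theory Num.Theory.
Import numFieldNormedType.Exports.
Local Open Scope classical_set_scope.
Local Open Scope ring_scope.

(** Write [a n = |f n| * beta n], so that the norm of [f] is the l^p norm of
    [a], and similarly [b] for [g]. The triangle inequality bounds the
    [n]-th weighted modulus of the product by the sum over [k] of
    [c n k * a k * b (n - k)], where [c] is the kernel whose [q]-th powers
    have row sums at most [C_o]. Hoelder's inequality in [k] bounds its
    [p]-th power by [C_o `^ (p / q)] times the sum over [k] of
    [a k `^ p * b (n - k) `^ p], the [n]-th coefficient of the Cauchy
    product of two summable nonnegative sequences. Summing over [n] gives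
    the norm estimate ([lpbeta_diamond]), which yields stability, the
    operator norm bound and the algebra inequality.

    Dividing the [n]-th coefficient by [delta n] transports the weighted
    product to the Cauchy product; since a given coefficient depends on
    finitely many others, commutativity and associativity follow from those
    of polynomials ([diamondC], [diamondA]). That the space is a Banach
    space is Minkowski's inequality and the usual argument through
    coefficientwise limits ([lpbeta_complete]).

    The series defining the norm only matters through [lpbeta_partial_le]
    and [lpbeta_bounded], which say that the norm is the least upper bound
    of the norms of the initial segments; all estimates are then made on
    finite sums. *)

(** * Finite l^p norms *)

Lemma powRVK {R : realType} (r x : R) : r != 0 -> 0 <= x ->
  (x `^ r) `^ r^-1 = x.
Proof. by move=> r0 x0; rewrite -powRrM divff// powRr1. Qed.

Lemma powRKV {R : realType} (r x : R) : r != 0 -> 0 <= x ->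
  (x `^ r^-1) `^ r = x.
Proof. by move=> r0 x0; rewrite -powRrM mulVf// powRr1. Qed.

Lemma ler_powR_base {R : realType} (r x y : R) : 0 <= r -> 0 <= x -> x <= y ->
  x `^ r <= y `^ r.
Proof.
move=> r0 x0 xy; apply: ge0_ler_powR; rewrite ?nnegrE//.
exact: le_trans xy.
Qed.

(** The norm of the first [N] terms only: the norm estimates are
    proved at this finite level, uniformly in [N]. *)
Definition lp_norm {R : realType} (p : R) (N : nat) (a : nat -> R) : R :=
  (\sum_(k < N) `|a k| `^ p) `^ p^-1.

Lemma lp_norm_ge0 {R : realType} (p : R) (N : nat) (a : nat -> R) :
  0 <= lp_norm p N a.
Proof. exact: powR_ge0. Qed.

Lemma lp_normK {R : realType} (p : R) (N : nat) (a : nat -> R) : 0 < p ->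
  lp_norm p N a `^ p = \sum_(k < N) `|a k| `^ p.
Proof.
by move=> p0; rewrite powRKV ?gt_eqF// sumr_ge0// => k _; rewrite powR_ge0.
Qed.

Lemma lp_norm_le {R : realType} (p c : R) (N : nat) (a : nat -> R) : 0 < p ->
  0 <= c -> \sum_(k < N) `|a k| `^ p <= c `^ p -> lp_norm p N a <= c.
Proof.
move=> p0 c0 ac; rewrite -[leRHS](@powRVK _ p) ?gt_eqF//.
apply: ler_powR_base => //; first by rewrite invr_ge0 ltW.
by apply: sumr_ge0 => k _; exact: powR_ge0.
Qed.

Lemma ler_lp_norm {R : realType} (p : R) (N : nat) (a b : nat -> R) : 0 < p ->
  (forall k, (k < N)%N -> `|a k| <= `|b k|) -> lp_norm p N a <= lp_norm p N b.
Proof.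
move=> p0 ab; apply: lp_norm_le => //; first exact: lp_norm_ge0.
rewrite lp_normK//; apply: ler_sum => k _.
by apply: ler_powR_base; rewrite ?(ltW p0)// ab.
Qed.

Lemma ler_lp_norm_coef {R : realType} (p : R) (N k : nat) (a : nat -> R) :
  0 < p -> (k < N)%N -> `|a k| <= lp_norm p N a.
Proof.
move=> p0 kN; rewrite -[leLHS](@powRVK _ p) ?gt_eqF//.
apply: ler_powR_base; rewrite ?invr_ge0 ?(ltW p0) ?powR_ge0//.
rewrite (bigD1 (Ordinal kN))//= lerDl; apply: sumr_ge0 => j _; exact: powR_ge0.
Qed.

(** Coordinatewise convergence controls finitely many coordinates at once;
    this is what allows passing to the limit in the partial norms. *)
Lemma lp_norm_small {R : realType} (p e : R) (N : nat) : 0 < p -> 0 < e ->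
  exists2 d, 0 < d &
    forall a : nat -> R, (forall k : 'I_N, `|a k| <= d) -> lp_norm p N a <= e.
Proof.
move=> p0 e0.
(* The sum of the [N] terms [d `^ p] has to stay below [e `^ p]; dividing by
   [N.+1] rather than [N] covers the case where [N] is zero. *)
exists ((e `^ p / N.+1%:R) `^ p^-1) => [|a ad].
  by rewrite powR_gt0// divr_gt0// powR_gt0.
apply: lp_norm_le => //; first exact: ltW.
apply: (@le_trans _ _ (\sum_(k < N) e `^ p / N.+1%:R)).
  apply: ler_sum => k _; rewrite -[leRHS](@powRKV _ p) ?gt_eqF//; last first.
    by rewrite divr_ge0// powR_ge0.
  by apply: ler_powR_base => //; exact: ltW.
rewrite sumr_const card_ord -mulrnAr ler_piMr ?powR_ge0//.
by rewrite -mulr_natl mulrC ler_pdivrMl// mulr1 ler_nat.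
Qed.

Definition truncation {R : realType} (N : nat) (a : nat -> R) : nat -> R :=
  fun k => if (k < N)%N then a k else 0.

(** Cutting [a] off at [N] makes the L^p norm for the counting measure a
    finite sum, so that the integral inequalities of Hoelder and Minkowski
    specialize to finite sequences. *)
Lemma Lnorm_counting_lp_norm {R : realType} (p : R) (N : nat) (a : nat -> R) :
  0 < p ->
  'N[counting]_p%:E[EFin \o truncation N a]%E =
    (lp_norm p N a)%:E.
Proof.
move=> p0; rewrite Lnorm_counting//.
rewrite (@nneseries_split _ _ 0 N); last by move=> k _; rewrite poweR_ge0.
rewrite add0n eseries0 ?adde0; last first.
  by move=> k /= Nk _; rewrite /truncation ltnNge Nk/= normr0 powR0// gt_eqF.
rewrite big_mkord (eq_bigr (fun k : 'I_N => (`|a k| `^ p)%:E)); last first.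
  by move=> k _; rewrite -poweR_EFin /= /truncation ltn_ord.
by rewrite sumEFin poweR_EFin.
Qed.

Lemma finite_hoelder {R : realType} (p q : R) (N : nat) (a b : nat -> R) :
  0 < p -> 0 < q -> p^-1 + q^-1 = 1 ->
  \sum_(k < N) `|a k * b k| <= lp_norm p N a * lp_norm q N b.
Proof.
move=> p0 q0 pq.
have mf (c : nat -> R) : measurable_fun setT
  (truncation N c) by [].
have := hoelder counting (mf a) (mf b) p0 q0 pq.
rewrite !Lnorm_counting_lp_norm// -EFinM => h.
rewrite -lee_fin; apply: le_trans h.
have -> : truncation N a \*
    truncation N b =
    truncation N (fun k => a k * b k).
  by apply/funext => k; rewrite /truncation/=; case: ifP; rewrite ?mulr0.
rewrite (Lnorm_counting_lp_norm 1)// lee_fin /lp_norm invr1 powRr1; last first.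
  by apply: sumr_ge0 => k _; exact: powR_ge0.
by apply: ler_sum => k _; rewrite powRr1.
Qed.

Lemma lp_normD {R : realType} (p : R) (N : nat) (a b : nat -> R) : 1 <= p ->
  lp_norm p N (fun k => a k + b k) <= lp_norm p N a + lp_norm p N b.
Proof.
move=> p1; have p0 : 0 < p by apply: lt_le_trans p1.
have mf (c : nat -> R) : measurable_fun setT
  (truncation N c) by [].
have := minkowski_EFin counting (mf a) (mf b) p1.
have -> : truncation N a \+
    truncation N b =
    truncation N (fun k => a k + b k).
  by apply/funext => k; rewrite /truncation/=; case: ifP; rewrite ?addr0.
by rewrite !Lnorm_counting_lp_norm.
Qed.

(** * Complex modulus and completeness *)

Lemma normc_ge0 {R : realType} (z : R[i]) : 0 <= Normc.normc z.
Proof. by case: z => x y; exact: sqrtr_ge0. Qed.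

Lemma normc_real {R : realType} (x : R) : Normc.normc x%:C%C = `|x|.
Proof. by rewrite /= expr0n addr0 sqrtr_sqr. Qed.

Lemma normc_sum {R : realType} (n : nat) (F : 'I_n -> R[i]) :
  Normc.normc (\sum_(k < n) F k) <= \sum_(k < n) Normc.normc (F k).
Proof.
elim/big_ind2 : _ => [|x a y b xa yb|//]; first by rewrite Normc.normc0.
by apply: le_trans (le_normcD _ _) _; exact: lerD.
Qed.

Lemma normc_Re {R : realType} (z : R[i]) : `|complex.Re z| <= Normc.normc z.
Proof.
case: z => x y /=; rewrite -sqrtr_sqr ler_wsqrtr// lerDl; exact: sqr_ge0.
Qed.

Lemma normc_Im {R : realType} (z : R[i]) : `|complex.Im z| <= Normc.normc z.
Proof.
case: z => x y /=; rewrite -sqrtr_sqr ler_wsqrtr// lerDr; exact: sqr_ge0.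
Qed.

Lemma normc_le_ReIm {R : realType} (z : R[i]) :
  Normc.normc z <= `|complex.Re z| + `|complex.Im z|.
Proof.
case: z => x y.
have -> : (x +i* y)%C = x%:C%C + (0 +i* y)%C.
  by rewrite /=; congr Complex; rewrite ?addr0 ?add0r.
apply: le_trans (le_normcD _ _) _.
by rewrite normc_real /= expr0n !add0r addr0 sqrtr_sqr.
Qed.

Lemma real_cauchy_cvg {R : realType} (u : nat -> R) :
  (forall e, 0 < e -> exists n0 : nat, forall m n : nat,
     (n0 <= m)%N -> (n0 <= n)%N -> `|u m - u n| < e) ->
  u @ \oo --> limn u.
Proof.
move=> uC; suff: cvgn u by [].
apply: cauchy_cvg; apply/cauchyP => e e0; have [n0 un0] := uC e e0.
exists (u n0); exists n0 => // m /= n0m; exact: un0.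
Qed.

(** Completeness of the real line, applied to real and imaginary parts. *)
Lemma complex_cauchy_cvg {R : realType} (u : nat -> R[i]) :
  (forall e, 0 < e -> exists n0 : nat, forall m n : nat,
     (n0 <= m)%N -> (n0 <= n)%N -> Normc.normc (u m - u n) < e) ->
  exists l, forall e, 0 < e -> \forall m \near \oo, Normc.normc (u m - l) < e.
Proof.
move=> uC.
pose re m := complex.Re (u m); pose im m := complex.Im (u m).
have ReC : re @ \oo --> limn re.
  apply: real_cauchy_cvg => e /uC[n0 un0]; exists n0 => m n mn0 nn0 /=.
  by rewrite -raddfB; apply: le_lt_trans (normc_Re _) _; exact: un0.
have ImC : im @ \oo --> limn im.
  apply: real_cauchy_cvg => e /uC[n0 un0]; exists n0 => m n mn0 nn0 /=.
  by rewrite -raddfB; apply: le_lt_trans (normc_Im _) _; exact: un0.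
exists (limn re +i* limn im)%C => e e0.
have e20 : 0 < e / 2 by rewrite divr_gt0.
move/cvgrPdist_lt : ReC => /(_ _ e20) ReC.
move/cvgrPdist_lt : ImC => /(_ _ e20) ImC.
near=> m.
apply: le_lt_trans (normc_le_ReIm _) _; rewrite [ltRHS]splitr !raddfB/=.
by apply: ltrD; rewrite distrC; near: m.
Unshelve. all: by end_near. Qed.

(** * The Banach space of weighted p-summable series *)

Definition weighted_mod {R : realType} (beta : nat -> R) (f : fps R) :
  nat -> R :=
  fun n => Normc.normc (f n) * beta n.

Lemma weighted_mod_ge0 {R : realType} (beta : nat -> R) (f : fps R) n :
  (forall n, 0 < beta n) -> 0 <= weighted_mod beta f n.
Proof. by move=> b0; rewrite mulr_ge0 ?normc_ge0// ltW. Qed.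

Lemma lpbeta_powsumE {R : realType} (p : R) (beta : nat -> R) (f : fps R) :
  (forall n, 0 < beta n) ->
  lpbeta_powsum p beta f =
  (\sum_(0 <= n <oo) (`|weighted_mod beta f n| `^ p)%:E)%E.
Proof.
move=> b0; apply: eq_eseriesr => n _.
by rewrite ger0_norm ?weighted_mod_ge0// powRM ?normc_ge0// ltW.
Qed.

(** Together with [lpbeta_bounded], this reduces statements about the
    infinite series defining the space and its norm to bounds on partial
    norms. *)
Lemma lpbeta_partial_le {R : realType} (p : R) (beta : nat -> R) (f : fps R)
    (N : nat) :
  (forall n, 0 < beta n) -> 0 < p -> lpbeta p beta f ->
  lp_norm p N (weighted_mod beta f) <= lpbeta_norm p beta f.
Proof.
move=> b0 p0 fE.
have s0 : (0 <= lpbeta_powsum p beta f)%E.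
  rewrite lpbeta_powsumE//; apply: nneseries_ge0 => k _ _.
  by rewrite lee_fin powR_ge0.
apply: lp_norm_le => //; first exact: powR_ge0.
rewrite powRKV ?gt_eqF ?fine_ge0// -lee_fin fineK ?ge0_fin_numE//.
rewrite lpbeta_powsumE// -sumEFin.
rewrite -(big_mkord xpredT (fun k => (`|weighted_mod beta f k| `^ p)%:E)).
by apply: nneseries_lim_ge => k _ _; rewrite lee_fin powR_ge0.
Qed.

Lemma lpbeta_bounded {R : realType} (p c : R) (beta : nat -> R) (f : fps R) :
  (forall n, 0 < beta n) -> 0 < p -> 0 <= c ->
  (forall N, lp_norm p N (weighted_mod beta f) <= c) ->
  lpbeta p beta f /\ lpbeta_norm p beta f <= c.
Proof.
move=> b0 p0 c0 fc.
have s0 : (0 <= lpbeta_powsum p beta f)%E.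
  rewrite lpbeta_powsumE//; apply: nneseries_ge0 => k _ _.
  by rewrite lee_fin powR_ge0.
have sc : (lpbeta_powsum p beta f <= (c `^ p)%:E)%E.
  rewrite lpbeta_powsumE//; apply: lime_le.
    by apply: is_cvg_ereal_nneg_natsum => k _; rewrite lee_fin powR_ge0.
  apply: nearW => N; rewrite big_mkord sumEFin lee_fin -lp_normK//.
  by apply: ler_powR_base => //; [exact: ltW | exact: powR_ge0].
have fE : lpbeta p beta f by exact: (le_lt_trans sc (ltry _)).
split => //; rewrite -[leRHS](@powRVK _ p) ?gt_eqF//.
apply: ler_powR_base; rewrite ?invr_ge0 ?(ltW p0) ?fine_ge0//.
by rewrite -lee_fin fineK ?ge0_fin_numE.
Qed.

Lemma lpbeta_norm_ge0 {R : realType} (p : R) (beta : nat -> R) (f : fps R) :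
  0 <= lpbeta_norm p beta f.
Proof. exact: powR_ge0. Qed.

Lemma lpbeta_coef_le {R : realType} (p : R) (beta : nat -> R) (f : fps R) n :
  (forall n, 0 < beta n) -> 0 < p -> lpbeta p beta f ->
  weighted_mod beta f n <= lpbeta_norm p beta f.
Proof.
move=> b0 p0 fE; apply: le_trans (@lpbeta_partial_le _ p beta f n.+1 b0 p0 fE).
by apply: le_trans (ler_norm _) _; exact: ler_lp_norm_coef.
Qed.

Lemma lpbetaD {R : realType} (p : R) (beta : nat -> R) (f g : fps R) :
  (forall n, 0 < beta n) -> 1 <= p -> lpbeta p beta f -> lpbeta p beta g ->
  lpbeta p beta (f + g) /\
  lpbeta_norm p beta (f + g) <= lpbeta_norm p beta f + lpbeta_norm p beta g.
Proof.
move=> b0 p1 fE gE; have p0 : 0 < p by apply: lt_le_trans p1.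
apply: lpbeta_bounded => //; first by rewrite addr_ge0// lpbeta_norm_ge0.
move=> N.
apply: (@le_trans _ _ (lp_norm p N (weighted_mod beta f) +
                       lp_norm p N (weighted_mod beta g))).
  apply: le_trans (@lp_normD _ p N _ _ p1); apply: ler_lp_norm => // k _.
  rewrite !ger0_norm ?addr_ge0 ?weighted_mod_ge0//.
  by rewrite -mulrDl ler_wpM2r ?(ltW (b0 _))//; exact: le_normcD.
by apply: lerD; exact: lpbeta_partial_le.
Qed.

Lemma lpbetaZ_le {R : realType} (p : R) (beta : nat -> R) (a : R[i])
    (f : fps R) :
  (forall n, 0 < beta n) -> 0 < p -> lpbeta p beta f ->
  lpbeta p beta (a *: f) /\
  lpbeta_norm p beta (a *: f) <= Normc.normc a * lpbeta_norm p beta f.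
Proof.
move=> b0 p0 fE; have nf := lpbeta_norm_ge0 p beta f.
have na := normc_ge0 a.
apply: lpbeta_bounded => //; first by rewrite mulr_ge0.
move=> N; apply: lp_norm_le; rewrite ?mulr_ge0// powRM//.
have aw k :
    weighted_mod beta (a *: f) k = Normc.normc a * weighted_mod beta f k.
  by rewrite /weighted_mod mulrA -Normc.normcM.
under eq_bigr do rewrite aw normrM (ger0_norm na) powRM//.
rewrite -mulr_sumr ler_wpM2l ?powR_ge0//.
rewrite -(lp_normK p N (weighted_mod beta f) p0).
apply: (ler_powR_base p _ _ (ltW p0) (lp_norm_ge0 _ _ _)).
exact: lpbeta_partial_le.
Qed.

Lemma lpbeta0 {R : realType} (p : R) (beta : nat -> R) :
  (forall n, 0 < beta n) -> 0 < p ->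
  lpbeta p beta 0 /\ lpbeta_norm p beta 0 <= 0.
Proof.
move=> b0 p0; apply: lpbeta_bounded => // N; apply: lp_norm_le => //.
rewrite big1 ?powR_ge0// => k _.
by rewrite /weighted_mod Normc.normc0 mul0r normr0 powR0// gt_eqF.
Qed.

(** The inequality [lpbetaZ_le] applied to [a] and to its inverse. *)
Lemma lpbetaZ {R : realType} (p : R) (beta : nat -> R) (a : R[i])
    (f : fps R) :
  (forall n, 0 < beta n) -> 0 < p -> lpbeta p beta f ->
  lpbeta_norm p beta (a *: f) = Normc.normc a * lpbeta_norm p beta f.
Proof.
move=> b0 p0 fE; apply/eqP; rewrite eq_le (lpbetaZ_le _ _ _ _ b0 p0 fE).2/=.
have [->|a0] := eqVneq a 0; first by rewrite Normc.normc0 mul0r lpbeta_norm_ge0.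
have na : 0 < Normc.normc a.
  rewrite lt_neqAle normc_ge0 andbT eq_sym.
  by apply: contra a0 => /eqP/Normc.eq0_normc ->.
rewrite mulrC -ler_pdivlMr// mulrC -Normc.normcV.
have aK : a^-1 *: (a *: f) = f by apply/funext => n; exact: mulKf.
have [afE _] := lpbetaZ_le p beta a f b0 p0 fE.
have := (lpbetaZ_le p beta a^-1 (a *: f) b0 p0 afE).2.
by rewrite aK.
Qed.

(** A Cauchy sequence converges coefficientwise, because [beta k] times the
    modulus of the [k]-th coefficient is at most the norm. To bound a
    partial norm of [F n - f], insert a far term [F m]: by Minkowski it is
    at most the norm of [F n - F m] plus a partial norm of [F m - f], and
    the latter involves finitely many coefficients only, so it is
    arbitrarily small for [m] large. The resulting bound does not depend on
    the length of the partial norm. *)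
Lemma lpbeta_complete {R : realType} (p : R) (beta : nat -> R)
    (F : nat -> fps R) :
  (forall n, 0 < beta n) -> 1 <= p -> (forall n, lpbeta p beta (F n)) ->
  (forall e : R, 0 < e -> exists n0 : nat, forall m n : nat,
     (n0 <= m)%N -> (n0 <= n)%N -> lpbeta_norm p beta (F m - F n) < e) ->
  exists2 f, lpbeta p beta f &
    (fun n => lpbeta_norm p beta (F n - f)) @ \oo --> (0 : R).
Proof.
move=> b0 p1 FE FC; have p0 : 0 < p by apply: lt_le_trans p1.
have subE (f g : fps R) : lpbeta p beta f -> lpbeta p beta g ->
    lpbeta p beta (f - g).
  move=> fE gE; rewrite -scaleN1r.
  by apply: (lpbetaD _ _ _ _ b0 p1 fE (lpbetaZ_le _ _ _ _ b0 p0 gE).1).1.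
have coef_cvg k : exists l, forall e, 0 < e ->
    \forall m \near \oo, Normc.normc (F m k - l) < e.
  apply: (@complex_cauchy_cvg _ (fun m => F m k)) => e e0.
  have [n0 Fn0] := FC (e * beta k) (mulr_gt0 e0 (b0 k)).
  exists n0 => m n mn0 nn0; rewrite -(ltr_pM2r (b0 k)).
  apply: le_lt_trans (Fn0 m n mn0 nn0).
  exact: (lpbeta_coef_le p beta (F m - F n) k b0 p0 (subE _ _ (FE m) (FE n))).
have [f0 fP] := choice coef_cvg; pose f : fps R := f0.
have tail e : 0 < e -> exists n0 : nat, forall n, (n0 <= n)%N ->
    lpbeta p beta (F n - f) /\ lpbeta_norm p beta (F n - f) <= e.
  move=> e0; have [n0 Fn0] := FC e e0; exists n0 => n n0n.
  apply: lpbeta_bounded => //; first exact: ltW.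
  move=> N; apply/ler_addgt0Pr => eta eta0.
  have [d d0 dP] := lp_norm_small p eta N p0 eta0.
  have closeP : \forall m \near \oo,
      forall k : 'I_N, `|weighted_mod beta (F m - f) k| <= d.
    apply: filter_forall => k; have dk : 0 < d / beta k by rewrite divr_gt0.
    apply: filterS (fP k _ dk) => m; rewrite ltr_pdivlMr// => /ltW.
    by rewrite ger0_norm ?weighted_mod_ge0.
  near \oo => m.
  have n0m : (n0 <= m)%N by near: m; exact: nbhs_infty_ge.
  have close : forall k : 'I_N, `|weighted_mod beta (F m - f) k| <= d.
    by near: m.
  apply: (@le_trans _ _ (lp_norm p N (weighted_mod beta (F n - F m)) +
                         lp_norm p N (weighted_mod beta (F m - f)))).
    apply: le_trans (@lp_normD _ p N _ _ p1); apply: ler_lp_norm => // k _.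
    rewrite !ger0_norm ?addr_ge0 ?weighted_mod_ge0//.
    rewrite -mulrDl ler_wpM2r ?(ltW (b0 _))//.
    have -> : (F n - f) k = (F n - F m) k + (F m - f) k.
      have -> : F n - f = (F n - F m) + (F m - f) by rewrite addrA subrK.
      by [].
    exact: le_normcD.
  apply: lerD; last exact: dP.
  apply: le_trans (ltW (Fn0 n m n0n n0m)); apply: lpbeta_partial_le => //.
  exact: subE.
exists f.
  have [n0 /(_ n0 (leqnn _))[FfE _]] := tail 1 ltr01.
  by have := subE _ _ (FE n0) FfE; rewrite opprB addrC subrK.
apply/cvgrPdist_le => e e0; have [n0 Fn0] := tail e e0.
exists n0 => // n /= n0n.
by rewrite sub0r normrN ger0_norm ?lpbeta_norm_ge0//; exact: (Fn0 n n0n).2.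
Unshelve. all: by end_near. Qed.

Lemma lpbeta_banach {R : realType} (p : R) (beta : nat -> R) :
  (forall n, 0 < beta n) -> 1 <= p ->
  is_banach_space (lpbeta p beta) (lpbeta_norm p beta).
Proof.
move=> b0 p1; have p0 : 0 < p by apply: lt_le_trans p1.
split.
- exact: (lpbeta0 p beta b0 p0).1.
- by move=> f g fE gE; exact: (lpbetaD _ _ _ _ b0 p1 fE gE).1.
- by move=> a f fE; exact: (lpbetaZ_le _ _ _ _ b0 p0 fE).1.
- move=> f fE f0; apply/funext => n; apply: Normc.eq0_normc; apply/eqP.
  rewrite eq_le normc_ge0 andbT -(ler_pM2r (b0 n)) mul0r -f0.
  exact: lpbeta_coef_le.
- by move=> a f fE; exact: lpbetaZ.
- by move=> f g fE gE; exact: (lpbetaD _ _ _ _ b0 p1 fE gE).2.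
- by move=> F FE FC; exact: lpbeta_complete.
Qed.

(** * Algebra of the weighted Cauchy product *)

(** Dividing the [n]-th coefficient by [delta n] turns the weighted product
    into the ordinary Cauchy product (for [delta n = n!] these are
    exponential generating functions). A coefficient of a Cauchy product of
    index below [n] depends only on the coefficients of index below [n],
    hence truncated series, that is polynomials, suffice. *)
Definition egf_poly {R : realType} (delta : nat -> R) (n : nat) (f : fps R) :
  {poly R[i]} := \poly_(i < n) (f i / (delta i)%:C%C).

Lemma realC_neq0 {R : realType} (x : R) : 0 < x -> (x%:C%C : R[i]) != 0.
Proof. by move=> x0; rewrite (inj_eq (@complexI R)) gt_eqF. Qed.

Lemma coef_egf_diamond {R : realType} (delta : nat -> R) (n : nat)
    (f g : fps R) (k : nat) :
  (forall n, 0 < delta n) -> (k < n)%N ->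
  diamond delta f g k =
    (delta k)%:C%C * (egf_poly delta n f * egf_poly delta n g)`_k.
Proof.
move=> d0 kn; rewrite coefM mulr_sumr; apply: eq_bigr => j _.
have jk : (j <= k)%N by rewrite -ltnS.
rewrite !coef_poly (leq_ltn_trans jk kn) (leq_ltn_trans (leq_subr _ _) kn).
rewrite rmorphM/= fmorphV/= rmorphM/= invfM.
rewrite -!mulrA; congr (_ * _).
by rewrite [RHS]mulrCA; congr (_ * _); rewrite mulrC -!mulrA.
Qed.

Lemma eq_coefM_low {R : nzRingType} (p p' q q' : {poly R}) (k : nat) :
  (forall j, (j <= k)%N -> p`_j = p'`_j) ->
  (forall j, (j <= k)%N -> q`_j = q'`_j) ->
  (p * q)`_k = (p' * q')`_k.
Proof.
move=> pp qq; rewrite !coefM; apply: eq_bigr => j _.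
by rewrite pp ?qq// ?leq_subr// -ltnS.
Qed.

Lemma coef_egf_poly_diamond {R : realType} (delta : nat -> R) (n : nat)
    (f g : fps R) (k : nat) :
  (forall n, 0 < delta n) -> (k < n)%N ->
  (egf_poly delta n (diamond delta f g))`_k =
    (egf_poly delta n f * egf_poly delta n g)`_k.
Proof.
move=> d0 kn; rewrite [LHS]coef_poly kn (@coef_egf_diamond _ _ n)// mulrAC.
rewrite mulfV ?mul1r//.
exact: realC_neq0.
Qed.

Lemma diamondC {R : realType} (delta : nat -> R) (f g : fps R) :
  (forall n, 0 < delta n) -> diamond delta f g = diamond delta g f.
Proof.
move=> d0; apply/funext => n.
by rewrite !(@coef_egf_diamond _ _ n.+1)// [egf_poly _ _ f * _]mulrC.
Qed.

(** Associativity is inherited from polynomials: the [n]-th coefficients of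
    both sides are [delta n] times that of a product of three polynomials. *)
Lemma diamondA {R : realType} (delta : nat -> R) (f g h : fps R) :
  (forall n, 0 < delta n) ->
  diamond delta f (diamond delta g h) = diamond delta (diamond delta f g) h.
Proof.
move=> d0; apply/funext => n.
rewrite !(@coef_egf_diamond _ _ n.+1)//; congr (_ * _).
pose P := egf_poly delta n.+1.
transitivity ((P f * (P g * P h))`_n).
  by apply: eq_coefM_low => // j jn; rewrite coef_egf_poly_diamond.
by rewrite mulrA; apply: eq_coefM_low => // j jn; rewrite coef_egf_poly_diamond.
Qed.

Lemma diamond1l {R : realType} (delta : nat -> R) (f : fps R) :
  (forall n, 0 < delta n) -> delta 0%N = 1 ->
  diamond delta (fps_one R) f = f.
Proof.
move=> d0 d1; apply/funext => n.
rewrite /diamond big_ord_recl big1 ?addr0; last first.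
  by move=> k _; rewrite /fps_one mulr0 mul0r.
by rewrite subn0 d1 mul1r mulfV ?gt_eqF// mulr1 mul1r.
Qed.

Lemma diamond_linearl {R : realType} (delta : nat -> R) (a : R[i])
    (f g h : fps R) :
  diamond delta (a *: f + g) h = a *: diamond delta f h + diamond delta g h.
Proof.
apply/funext => n.
have -> : (a *: diamond delta f h + diamond delta g h) n =
  a * diamond delta f h n + diamond delta g h n by [].
rewrite /diamond mulr_sumr -big_split; apply: eq_bigr => k _ /=.
have -> : (a *: f + g) k = a * f k + g k by [].
by rewrite mulrDr mulrDl !mulrA [a * _]mulrC.
Qed.

(** * Norm estimate for the product *)

(** The left-hand side sums [A k * B j] over the triangle [k + j < N], which
    is contained in the square [k, j < N]. *)
Lemma sum_cauchy_product_le {R : realType} (A B : nat -> R) (N : nat) :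
  (forall n, 0 <= A n) -> (forall n, 0 <= B n) ->
  \sum_(n < N) \sum_(k < n.+1) A k * B (n - k)%N <=
    (\sum_(k < N) A k) * (\sum_(k < N) B k).
Proof.
move=> A0 B0.
rewrite (eq_bigr (fun n : 'I_N =>
    \sum_(k < N) if (k <= n)%N then A k * B (n - k)%N else 0)); last first.
  move=> n _; rewrite (big_ord_widen N (fun k => A k * B (n - k)%N))//.
  by rewrite big_mkcond.
rewrite exchange_big mulr_suml; apply: ler_sum => k _ /=.
rewrite -big_mkcond -mulr_sumr ler_wpM2l//.
rewrite -(big_geq_mkord k N xpredT (fun n : nat => B (n - k)%N)).
rewrite -{1}(add0n (k : nat)) big_addn.
under eq_bigr do rewrite addnK.
rewrite -(big_mkord xpredT B).
rewrite [leRHS](big_cat_nat (n := (N - k)%N)) ?leq_subr//=.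
by rewrite lerDl sumr_ge0.
Qed.

(** The coefficient of the weighted product once the coefficients of the
    factors and of the product are multiplied by [beta]; [C_o] is the
    supremum over [n] of the sum over [k] of its [q]-th powers. *)
Definition diamond_kernel {R : realType} (beta delta : nat -> R) (n k : nat) :
    R :=
  delta n * beta n / (delta k * delta (n - k)%N * beta k * beta (n - k)%N).

Lemma weighted_mod_diamond_le {R : realType} (beta delta : nat -> R)
    (f g : fps R) (n : nat) :
  (forall n, 0 < beta n) -> (forall n, 0 < delta n) ->
  weighted_mod beta (diamond delta f g) n <=
  \sum_(k < n.+1) `|diamond_kernel beta delta n k *
     (weighted_mod beta f k * weighted_mod beta g (n - k)%N)|.
Proof.
move=> b0 d0; rewrite /weighted_mod /diamond.
apply: le_trans (ler_wpM2r (ltW (b0 n)) (normc_sum _ _)) _.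
rewrite mulr_suml; apply: ler_sum => k _.
apply: le_trans (ler_norm _).
rewrite !Normc.normcM normc_real ger0_norm; last first.
  by rewrite divr_ge0 ?mulr_ge0// ltW.
rewrite /diamond_kernel le_eqVlt; apply/orP; left; apply/eqP.
by field; rewrite !gt_eqF.
Qed.

(** Hoelder's inequality in the inner sum separates the kernel, whose part
    is at most [C `^ q^-1] uniformly in [n], from the products of
    coefficients; the [p]-th powers of the latter form the Cauchy product of
    the summable sequences of [p]-th powers for [f] and [g], so their total
    is at most the product of the two sums. *)
Lemma lpbeta_diamond {R : realType} (p q C : R) (beta delta : nat -> R)
    (f g : fps R) :
  (forall n, 0 < beta n) -> (forall n, 0 < delta n) ->
  0 < p -> 0 < q -> p^-1 + q^-1 = 1 -> 0 <= C ->
  (forall n, \sum_(k < n.+1) diamond_kernel beta delta n k `^ q <= C) ->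
  lpbeta p beta f -> lpbeta p beta g ->
  lpbeta p beta (diamond delta f g) /\
  lpbeta_norm p beta (diamond delta f g) <=
    C `^ q^-1 * (lpbeta_norm p beta f * lpbeta_norm p beta g).
Proof.
move=> b0 d0 p0 q0 pq C0 kerC fE gE.
have nf := lpbeta_norm_ge0 p beta f; have ng := lpbeta_norm_ge0 p beta g.
apply: lpbeta_bounded => //; first by rewrite !mulr_ge0 ?powR_ge0.
move=> N; apply: lp_norm_le => //; first by rewrite !mulr_ge0 ?powR_ge0.
pose A k := `|weighted_mod beta f k| `^ p.
pose B k := `|weighted_mod beta g k| `^ p.
have A0 k : 0 <= A k by exact: powR_ge0.
have B0 k : 0 <= B k by exact: powR_ge0.
have pointwise n : `|weighted_mod beta (diamond delta f g) n| `^ p <=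
    (C `^ q^-1) `^ p * \sum_(k < n.+1) A k * B (n - k)%N.
  rewrite ger0_norm ?weighted_mod_ge0//.
  pose h k := weighted_mod beta f k * weighted_mod beta g (n - k)%N.
  have -> : \sum_(k < n.+1) A k * B (n - k)%N = lp_norm p n.+1 h `^ p.
    by rewrite lp_normK//; apply: eq_bigr => k _; rewrite normrM powRM.
  rewrite -powRM ?powR_ge0//.
  apply: ler_powR_base; rewrite ?(ltW p0) ?weighted_mod_ge0//.
  apply: le_trans (weighted_mod_diamond_le _ _ _ _ _ b0 d0) _.
  have qp : q^-1 + p^-1 = 1 by rewrite addrC.
  apply: le_trans
    (finite_hoelder q p n.+1 (diamond_kernel beta delta n) h q0 p0 qp) _.
  rewrite ler_wpM2r ?lp_norm_ge0//; apply: lp_norm_le; rewrite ?powR_ge0//.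
  rewrite powRKV ?gt_eqF//; apply: le_trans (kerC n); apply: ler_sum => k _.
  by rewrite ger0_norm// divr_ge0 ?mulr_ge0// ltW.
apply: (@le_trans _ _
  (\sum_(n < N) (C `^ q^-1) `^ p * \sum_(k < n.+1) A k * B (n - k)%N)).
  by apply: ler_sum => n _; exact: pointwise.
rewrite -mulr_sumr !powRM ?mulr_ge0 ?powR_ge0// ler_wpM2l ?powR_ge0//.
apply: le_trans (sum_cauchy_product_le _ _ _ A0 B0) _.
have le_pow h : lpbeta p beta h ->
    \sum_(k < N) `|weighted_mod beta h k| `^ p <= lpbeta_norm p beta h `^ p.
  move=> hE; rewrite -(lp_normK p N (weighted_mod beta h) p0).
  apply: (ler_powR_base p _ _ (ltW p0) (lp_norm_ge0 _ _ _)).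
  exact: lpbeta_partial_le.
by apply: ler_pM; rewrite ?sumr_ge0// /A /B; exact: le_pow.
Qed.

Lemma diamond_const_ge0 {R : realType} (q : R) (beta delta : nat -> R) :
  (0 <= diamond_const q beta delta)%E.
Proof.
apply: (@le_trans _ _ (\sum_(k < 1) diamond_kernel beta delta 0 k `^ q)%:E);
  last first.
  by apply: ereal_sup_ubound; exists 0%N.
by rewrite lee_fin sumr_ge0// => k _; exact: powR_ge0.
Qed.

Lemma fps_one_lpbeta {R : realType} (p : R) (beta : nat -> R) :
  (forall n, 0 < beta n) -> 0 < p -> lpbeta p beta (fps_one R).
Proof.
move=> b0 p0.
have [] // := lpbeta_bounded p (beta 0%N) beta (fps_one R) b0 p0 (ltW (b0 _)).
move=> [|N]; apply: lp_norm_le; rewrite ?(ltW (b0 _))//.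
  by rewrite big_ord0 powR_ge0.
rewrite big_ord_recl big1 ?addr0; last first.
  by move=> k _; rewrite /weighted_mod Normc.normc0 mul0r normr0 powR0// gt_eqF.
by rewrite /weighted_mod Normc.normc1 mul1r ger0_norm// ltW.
Qed.

Theorem mainTheorem1 (R : realType) (beta delta : nat -> R) (p q : R)
  (beta_gt0 : forall n, 0 < beta n) (beta0 : beta 0%N = 1)
  (delta_gt0 : forall n, 0 < delta n) (delta0 : delta 0%N = 1)
  (p_gt1 : 1 < p) (pq : p^-1 + q^-1 = 1)
  (Co_fin : (diamond_const q beta delta < +oo)%E) :
  (forall f, lpbeta p beta f ->
     (forall g, lpbeta p beta g -> lpbeta p beta (diamond delta f g)) /\
     (operator_norm (lpbeta p beta) (lpbeta_norm p beta) (diamond delta f)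
        <= diamond_const q beta delta `^ q^-1 * (lpbeta_norm p beta f)%:E)%E) /\
  is_unital_commutative_banach_algebra (lpbeta p beta) (lpbeta_norm p beta)
    (diamond delta) (fps_one R).
Proof.
have p_ge1 := ltW p_gt1; have p_gt0 : 0 < p by exact: lt_trans p_gt1.
have q_gt0 : 0 < q.
  by rewrite -invr_gt0 -(addKr p^-1 q^-1) pq addrC subr_gt0 invf_lt1.
have Co_ge0 := diamond_const_ge0 q beta delta.
pose C := fine (diamond_const q beta delta).
have CE : diamond_const q beta delta = C%:E by rewrite fineK ?ge0_fin_numE.
have C_ge0 : 0 <= C by exact: fine_ge0.
have kerC n : \sum_(k < n.+1) diamond_kernel beta delta n k `^ q <= C.
  by rewrite -lee_fin -CE; apply: ereal_sup_ubound; exists n.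
have bound f g := lpbeta_diamond p q C beta delta f g beta_gt0 delta_gt0
  p_gt0 q_gt0 pq C_ge0 kerC.
split.
  move=> f fE; split=> [g gE|]; first exact: (bound f g fE gE).1.
  apply: ge_ereal_sup => _ [g [gE g1] <-].
  rewrite CE poweR_EFin -EFinM lee_fin; apply: le_trans (bound f g fE gE).2 _.
  rewrite ler_wpM2l ?powR_ge0//; apply: ler_piMr => //; exact: lpbeta_norm_ge0.
split.
- split.
  + exact: lpbeta_banach.
  + by move=> f g fE gE; exact: (bound f g fE gE).1.
  + by move=> f g h _ _ _; exact: diamondA.
  + by move=> a f g h _ _ _; exact: diamond_linearl.
  + by move=> a f g h _ _ _; rewrite !(diamondC delta f)// diamond_linearl.
  + by exists (C `^ q^-1) => f g fE gE; exact: (bound f g fE gE).2.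
- by move=> f g _ _; exact: diamondC.
- exact: fps_one_lpbeta.
- by move=> f _; exact: diamond1l.
Qed.
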